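(* Let $r,s,t$ be odd integers with $r\in\{31,33,\ldots,75\}$ (the odd integers from $31$ to $75$) and $s,t\in\{45,55,65,75\}$, such that $K_{r,s,t}$ satisfies the necessary conditions. Then $K_{r,s,t}$ has a decomposition into $5$-cycles.
   Context: $K_{r,s,t}$ denotes the complete tripartite graph with parts of sizes $r,s,t$. A decomposition of a graph into $5$-cycles is a partition of its edge set into edge sets of cycles of length $5$. The graph $K_{r,s,t}$ is said to satisfy the necessary conditions if: (i) $5\mid rs+rt+st$; (ii) $r\equiv s\equiv t \pmod 2$; (iii) when the three part sizes are listed as $x\le y\le z$, one has $z\le 4xy/(x+y)$. *)

(* Defs.v *)
From HB Require Import structures.
From mathcomp Require Import all_boot all_order all_algebra.

Set Implicit Arguments.
Unset Strict Implicit.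
Unset Printing Implicit Defensive.

(* A finite simple graph is a symmetric irreflexive relation on a finType;
   its edges are two-element sets of vertices. *)
Definition edge_set (T : finType) (e : rel T) : {set {set T}} :=
  [set [set p.1; p.2] | p : T * T & e p.1 p.2].

Definition cycle_edges (T : finType) (c : seq T) : {set {set T}} :=
  [set [set x; next c x] | x in c].

(* Intended for 3 <= k: ucycle also accepts shorter closed walks. *)
Definition is_cycle_edge_set (T : finType) (e : rel T) (k : nat)
    (C : {set {set T}}) : Prop :=
  exists c : seq T, [/\ size c = k, ucycle e c & C = cycle_edges c].

Definition has_cycle_decomposition (T : finType) (e : rel T) (k : nat) : Prop :=
  exists P : {set {set {set T}}},
    partition P (edge_set e) /\
    (forall C : {set {set T}}, C \in P -> is_cycle_edge_set e k C).

Definition tripartite_vertex (r s t : nat) : finType :=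
  ('I_r + 'I_s + 'I_t)%type.

Definition part_of (r s t : nat) (v : tripartite_vertex r s t) : nat :=
  match v with
  | inl (inl _) => 0
  | inl (inr _) => 1
  | inr _ => 2
  end.

Definition complete_tripartite (r s t : nat) : rel (tripartite_vertex r s t) :=
  fun u v => part_of u != part_of v.

Definition necessary_conditions (r s t : nat) : Prop :=
  [/\ 5 %| r * s + r * t + s * t,
      r = s %[mod 2] /\ s = t %[mod 2]
    & forall x y z : nat, perm_eq [:: x; y; z] [:: r; s; t] ->
        x <= y -> y <= z ->
        (z%:R <= 4 * x%:R * y%:R / (x%:R + y%:R) :> rat)%R].

(* Main.v *)
Require Import Defs.
From HB Require Import structures.
From mathcomp Require Import all_boot all_order all_algebra.
From mathcomp Require Import zify.

(** Call [K_{r,s,t}] pentagonal when its edges can be partitioned into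
5-cycles.  The idea is to cut the three parts into classes of small odd sizes
and to regard the classes as the vertices of a weighted skeleton graph.  If
the skeleton is decomposed into triangles and pentagons, its blow-up splits
into copies of [K_{x,y,z}], one for each triangle with weights [x, y, z], and
blown-up pentagons.  A pentagon whose vertices all have weight 5 blows up to a
pentagonal graph ([pentagonal_pent_copies]), so only the [K_{x,y,z}] are
left, and they are smaller than the graph at the start
([pentagonal_K_skeleton]).  A triangle of the skeleton may be replaced by a
complete tripartite block on several classes at once.

This leaves three kinds of input.  The graphs [K_{w,5,5}] for [w = 3, 5, 7, 9]
are decomposed by explicit lists.  When [s = t = 5n], the Latin square of
[Z_n] decomposes the skeleton [K_{n,n,n}] into triangles, and since each
triangle meets only one class of the first part, these classes may have any
sizes in [3, 5, 7, 9]; trading three symbols of the Latin square for one class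
of size 5 lying on [n] pentagons gives smaller [r] ([pentagonal_K_cyclic]).
Finally [K_{w,15,25}] has explicit lists for [w = 11, 13, 21, 23], while for
[w = 15, 25] it has two equal parts.  So [K_{w,x,y}] is pentagonal for every
[w] in [11, 13, 15, 21, 23, 25] and all [x, y] in [15, 25]
([pentagonal_K_block]).

For [r >= 33] the Latin square of order 3 finishes the proof: each of 45, 55,
65, 75 is a sum of three terms 15 or 25, and [r] is a sum of three of the
admissible [w].  The inequality [25 <= 4 * 15 * w / (15 + w)] forces [w >= 11]
in a block [K_{w,15,25}], so three such summands cannot add up to 31.  If
[r = 31] and [s = t], a cyclic skeleton works.  If [r = 31] and [s < t], one
class of size 11 is joined to three diagonal blocks with parts of sizes 15 and
25, and the other 20 vertices form four classes of size 5; what then remains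
of the skeleton is decomposed into triangles and pentagons by an explicit list
([pentagonal_K_31_skeleton]).  The triple [(31, 45, 75)], in either order of
the last two parts, violates the inequality in the necessary conditions. *)

Set Implicit Arguments.
Unset Strict Implicit.
Unset Printing Implicit Defensive.

(** * Decompositions of multigraphs into pentagons *)

Definition pentagon (V : eqType) (c : seq V) := uniq c && (size c == 5).

(** Each edge is listed in both directions, so that an undirected multigraph is
a symmetric multiplicity function on ordered pairs. *)
Definition arcs (V : Type) (c : seq V) : seq (V * V) :=
  zip c (rot 1 c) ++ zip (rot 1 c) c.

Definition all_arcs (V : Type) (cs : seq (seq V)) : seq (V * V) :=
  flatten (map (@arcs V) cs).

(** Working with edge multiplicities instead of edge sets makes edge-disjoint
union plain addition of functions, with no disjointness to prove. *)
Definition pentagonal (V : eqType) (f : V -> V -> nat) : Prop :=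
  exists2 cs, all (@pentagon V) cs
            & forall u v, count_mem (u, v) (all_arcs cs) = f u v.

(** The value 0 marks the vertices outside the graph, which lets several
blocks live on one vertex type. *)
Definition part_index (V : eqType) (A B C : seq V) (u : V) : nat :=
  if u \in A then 1 else if u \in B then 2 else if u \in C then 3 else 0.

Definition tripartite (V : eqType) (A B C : seq V) (u v : V) : bool :=
  let i := part_index A B C u in let j := part_index A B C v in
  [&& i != 0, j != 0 & i != j].

Definition pentagonal_K (r s t : nat) : Prop :=
  pentagonal (tripartite (iota 0 r) (iota r s) (iota (r + s) t)).

Lemma pentagonal_ext (V : eqType) (f g : V -> V -> nat) :
  f =2 g -> pentagonal f -> pentagonal g.
Proof. by move=> eq_fg [cs Hcs Hf]; exists cs => // u v; rewrite Hf. Qed.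

Lemma pentagonal_add (V : eqType) (f g : V -> V -> nat) :
  pentagonal f -> pentagonal g -> pentagonal (fun u v => f u v + g u v).
Proof.
move=> [cs Hcs Hf] [ds Hds Hg]; exists (cs ++ ds); first by rewrite all_cat Hcs.
by move=> u v; rewrite /all_arcs map_cat flatten_cat count_cat Hf Hg.
Qed.

Lemma pentagonal_sum (V I : eqType) (f : I -> V -> V -> nat) (bs : seq I) :
  (forall b, b \in bs -> pentagonal (f b)) ->
  pentagonal (fun u v => \sum_(b <- bs) f b u v).
Proof.
elim: bs => [|b bs IH] Hbs.
  by exists [::] => // u v; rewrite big_nil.
apply: (@pentagonal_ext _ (fun u v => f b u v + \sum_(b <- bs) f b u v)).
  by move=> u v; rewrite big_cons.
apply: pentagonal_add; first by apply: Hbs; rewrite mem_head.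
by apply: IH => c cbs; apply: Hbs; rewrite inE cbs orbT.
Qed.

Lemma arcs_map (V W : Type) (h : V -> W) (c : seq V) :
  arcs (map h c) = [seq (h p.1, h p.2) | p <- arcs c].
Proof.
rewrite /arcs map_cat -map_rot; congr (_ ++ _).
  by elim: c (rot 1 c) => [|x c IH] [|y d] //=; rewrite IH.
by elim: c (rot 1 c) => [|x c IH] [|y d] //=; rewrite IH.
Qed.

Lemma pentagon_mem_arcs (V : eqType) (c : seq V) u :
  pentagon c -> u \in c -> exists v, (u, v) \in arcs c.
Proof.
case: c => [|a [|b [|c [|d [|e [|? ?]]]]]] //=;
  rewrite /pentagon ?andbF // => _.
rewrite /arcs /= !inE => /or4P[/eqP->|/eqP->|/eqP->|/orP[/eqP->|/eqP->]];
  [exists b|exists c|exists d|exists e|exists a];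
  by rewrite !inE eqxx ?orbT.
Qed.

Lemma count_map_inj_in (V W : eqType) (D : {pred V}) (h : V -> W)
    (s : seq (V * V)) u v :
    {in D &, injective h} ->
    (forall p, p \in s -> (p.1 \in D) && (p.2 \in D)) ->
    u \in D -> v \in D ->
  count_mem (h u, h v) [seq (h p.1, h p.2) | p <- s] = count_mem (u, v) s.
Proof.
move=> inj_h sD uD vD; rewrite count_map; apply: eq_in_count => -[a b] /sD /=.
case/andP=> aD bD; rewrite !xpair_eqE; congr (_ && _).
  by apply/eqP/eqP => [/inj_h->|->].
by apply/eqP/eqP => [/inj_h->|->].
Qed.

(** The embedding [h] need only be injective on a domain [D] that carries all
the edges of [f]; the graph [g] must have no edge outside the image. *)
Lemma pentagonal_image (V W : eqType) (D : {pred V}) (h : V -> W)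
    (f : V -> V -> nat) (g : W -> W -> nat) :
    {in D &, injective h} ->
    (forall u v, f u v != 0 -> (u \in D) && (v \in D)) ->
    {in D &, forall u v, g (h u) (h v) = f u v} ->
    (forall x y, g x y != 0 -> exists2 u, u \in D &
       exists2 v, v \in D & (x, y) = (h u, h v)) ->
  pentagonal f -> pentagonal g.
Proof.
move=> inj_h fD gf gD [cs cs5 csf].
have arcD p : p \in all_arcs cs -> (p.1 \in D) && (p.2 \in D).
  by case: p => u v uv; apply: fD; rewrite -csf -lt0n -has_count has_pred1.
have arcD' c u : c \in cs -> u \in c -> u \in D.
  move=> ccs uc; have [v uv] := pentagon_mem_arcs (allP cs5 _ ccs) uc.
  have /arcD /andP[] // : (u, v) \in all_arcs cs.
  by apply/flattenP; exists (arcs c) => //; apply: map_f.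
exists (map (map h) cs).
  apply/allP => _ /mapP[c ccs ->]; move/allP: (cs5) => /(_ c ccs) /andP[Uc sc].
  rewrite /pentagon size_map sc andbT map_inj_in_uniq // => u v uc vc.
  by apply: inj_h; apply: (arcD' c).
have -> : all_arcs (map (map h) cs) = [seq (h p.1, h p.2) | p <- all_arcs cs].
  rewrite /all_arcs map_flatten -!map_comp; congr flatten.
  by apply: eq_map => c /=; apply: arcs_map.
move=> x y; have [gxy|gxy] := eqVneq (g x y) 0; last first.
  have [u uD [v vD [-> ->]]] := gD x y gxy.
  by rewrite (count_map_inj_in inj_h arcD) // csf gf.
rewrite gxy; apply/eqP; rewrite -leqn0 leqNgt -has_count has_pred1.
apply/mapP => -[[u v] uv [ex ey]]; have /andP[/= uD vD] := arcD _ uv.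
move: gxy; rewrite ex ey gf // -csf => /eqP.
by rewrite -leqn0 leqNgt -has_count has_pred1 uv.
Qed.

Lemma part_index_neq0 (V : eqType) (A B C : seq V) u :
  (part_index A B C u != 0) = (u \in A ++ B ++ C).
Proof. by rewrite /part_index !mem_cat; do 3 case: ifP => // _. Qed.

Lemma tripartite_mem (V : eqType) (A B C : seq V) u v :
  tripartite A B C u v -> (u \in A ++ B ++ C) && (v \in A ++ B ++ C).
Proof. by rewrite -!part_index_neq0 => /and3P[-> ->]. Qed.

Lemma part_index_nth (V : eqType) (A B C : seq V) x0 i :
    uniq (A ++ B ++ C) -> i < size (A ++ B ++ C) ->
  part_index A B C (nth x0 (A ++ B ++ C) i) =
    if i < size A then 1 else if i < size A + size B then 2 else 3.
Proof.
rewrite !cat_uniq has_cat negb_or !size_cat.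
case/and3P=> _ /andP[/hasPn BA /hasPn CA] /and3P[_ /hasPn CB _] lt_i.
rewrite /part_index !nth_cat.
have [iA|Ai] := ltnP i (size A); first by rewrite mem_nth.
have -> : (i - size A < size B) = (i < size A + size B) by rewrite ltn_subLR.
have [iB|Bi] := ltnP i (size A + size B).
  have xB : nth x0 B (i - size A) \in B by rewrite mem_nth // ltn_subLR.
  by rewrite (negbTE (BA _ xB)) xB.
have xC : nth x0 C (i - size A - size B) \in C.
  by rewrite mem_nth // -subnDA ltn_subLR // -addnA.
by rewrite (negbTE (CA _ xC)) (negbTE (CB _ xC)) xC.
Qed.

(** Only the sizes of the parts matter: the vertex of rank [i] in the first
enumeration is sent to the vertex of rank [i] in the second. *)
Lemma pentagonal_transport (V W : eqType) (A B C : seq V) (A' B' C' : seq W)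
    (w0 : W) :
    uniq (A ++ B ++ C) -> uniq (A' ++ B' ++ C') ->
    size A = size A' -> size B = size B' -> size C = size C' ->
  pentagonal (tripartite A B C) -> pentagonal (tripartite A' B' C').
Proof.
set L := A ++ B ++ C; set L' := A' ++ B' ++ C' => UL UL' sA sB sC.
have sL : size L = size L' by rewrite !size_cat sA sB sC.
have pidx u : u \in L ->
    part_index A' B' C' (nth w0 L' (index u L)) = part_index A B C u.
  move=> uL; rewrite part_index_nth // -?sL ?index_mem //.
  by rewrite -[in RHS](nth_index u uL) part_index_nth ?index_mem // sA sB.
apply: (@pentagonal_image _ _ (mem L) (fun u => nth w0 L' (index u L))) => /=.
- move=> u v uL vL /eqP; rewrite nth_uniq -?sL ?index_mem // => /eqP.
  by apply: index_inj.
- by move=> u v; rewrite eqb0 negbK => /tripartite_mem.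
- by move=> u v uL vL; rewrite /tripartite !pidx.
have onto x : x \in L' -> exists2 u, u \in L & x = nth w0 L' (index u L).
  move=> xL'; have lt_x : index x L' < size L by rewrite sL index_mem.
  have [v0 _] : exists v0 : V, true by case: (L) lt_x => // v l _; exists v.
  exists (nth v0 L (index x L')); first exact: mem_nth.
  by rewrite index_uniq // nth_index.
move=> x y; rewrite eqb0 negbK.
move=> /tripartite_mem /andP[/onto[u uL ->] /onto[v vL ->]].
by exists u => //; exists v.
Qed.

Lemma iota3 r s t : iota 0 r ++ iota r s ++ iota (r + s) t = iota 0 (r + s + t).
Proof. by rewrite -iotaD -addnA -[X in iota X _]add0n -iotaD. Qed.

Lemma pentagonal_lists (W : eqType) (A B C : seq W) (w0 : W) :
    uniq (A ++ B ++ C) ->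
  pentagonal_K (size A) (size B) (size C) -> pentagonal (tripartite A B C).
Proof.
move=> UL; apply: pentagonal_transport; rewrite ?size_iota //.
by rewrite iota3 iota_uniq.
Qed.

Lemma pentagonal_K_of_lists (V : eqType) (A B C : seq V) :
    uniq (A ++ B ++ C) ->
  pentagonal (tripartite A B C) -> pentagonal_K (size A) (size B) (size C).
Proof.
move=> UL; apply: (pentagonal_transport 0); rewrite ?size_iota //.
by rewrite iota3 iota_uniq.
Qed.

Lemma pentagonal_K_swap12 r s t : pentagonal_K r s t -> pentagonal_K s r t.
Proof.
move=> H; have U : uniq (iota r s ++ iota 0 r ++ iota (r + s) t).
  by rewrite uniq_catCA iota3 iota_uniq.
have := @pentagonal_K_of_lists _ _ _ _ U; rewrite !size_iota; apply.
move: U; rewrite cat_uniq has_cat negb_or => /and3P[_ /andP[/hasPn sr _] _].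
apply: pentagonal_ext H => u v; rewrite /tripartite /part_index.
have dis x : (x \in iota 0 r) && (x \in iota r s) = false.
  by apply/negP => /andP[/sr/negP].
by move: (dis u) (dis v); do 6 case: (_ \in iota _ _).
Qed.

Lemma pentagonal_K_swap23 r s t : pentagonal_K r s t -> pentagonal_K r t s.
Proof.
move=> H; have U : uniq (iota 0 r ++ iota (r + s) t ++ iota r s).
  rewrite (perm_uniq (_ : perm_eq _ (iota 0 r ++ iota r s ++ iota (r + s) t))).
    by rewrite iota3 iota_uniq.
  by rewrite perm_cat2l perm_catC.
have := @pentagonal_K_of_lists _ _ _ _ U; rewrite !size_iota; apply.
move: U; rewrite cat_uniq => /and3P[_ _].
rewrite cat_uniq => /and3P[_ /hasPn st _].
apply: pentagonal_ext H => u v; rewrite /tripartite /part_index.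
have dis x : (x \in iota r s) && (x \in iota (r + s) t) = false.
  by apply/negP => /andP[/st/negP].
by move: (dis u) (dis v); do 6 case: (_ \in iota _ _).
Qed.

(** * Blowing up triangles and pentagons *)

(** The vertex [v] of a skeleton, of weight [w v], becomes the independent set
of the pairs [(v, x)] with [x < w v]. *)
Definition copies (w : nat -> nat) (L : seq nat) : seq (nat * nat) :=
  [seq (v, x) | v <- L, x <- iota 0 (w v)].

Lemma mem_copies w L u : (u \in copies w L) = (u.1 \in L) && (u.2 < w u.1).
Proof.
case: u => v x; apply/allpairsPdep/andP => /= [[v' [x' [vL]]]|[vL xw]].
  by rewrite mem_iota => /andP[_ ?] [-> ->].
by exists v, x; rewrite mem_iota.
Qed.

Lemma size_copies w L : size (copies w L) = sumn (map w L).
Proof.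
rewrite /copies size_allpairs_dep; congr sumn.
by apply: eq_map => v; rewrite size_iota.
Qed.

Lemma uniq_copies w L : uniq L -> uniq (copies w L).
Proof.
move=> UL; apply: allpairs_uniq_dep => // [v _|]; first exact: iota_uniq.
by move=> [v x] [v' x'] _ _ /= [-> ->].
Qed.

Lemma copies_cat w L M : copies w (L ++ M) = copies w L ++ copies w M.
Proof. by rewrite /copies map_cat flatten_cat. Qed.

Lemma tripartite_copies w A B C u v :
  tripartite (copies w A) (copies w B) (copies w C) u v =
    [&& u.2 < w u.1, v.2 < w v.1 & tripartite A B C u.1 v.1].
Proof.
have pidx x : part_index (copies w A) (copies w B) (copies w C) x =
    if x.2 < w x.1 then part_index A B C x.1 else 0.
  by rewrite /part_index !mem_copies; case: (x.2 < w _); rewrite ?andbT ?andbF.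
rewrite /tripartite !pidx; case: (u.2 < _) => //; case: (v.2 < _) => //=.
by rewrite andbF.
Qed.

Lemma pentagonal_tripartite_copies w A B C : uniq (A ++ B ++ C) ->
    pentagonal_K (sumn (map w A)) (sumn (map w B)) (sumn (map w C)) ->
  pentagonal (tripartite (copies w A) (copies w B) (copies w C)).
Proof.
move=> U; rewrite -!size_copies; apply: (pentagonal_lists (0, 0)).
by rewrite -!copies_cat; apply: uniq_copies.
Qed.

(** For consecutive classes, in cyclic order, the two forms among [x, y, x, y,
x + y] are independent over [Z_5].  Hence each edge between consecutive
classes determines [(x, y)] and lies on exactly one of the 25 pentagons. *)
Definition blown_pentagon : seq (seq (nat * nat)) :=
  [seq [:: (0, x); (1, y); (2, x); (3, y); (4, (x + y) %% 5)]
    | x <- iota 0 5, y <- iota 0 5].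

(** The blow-up of the cycle [c]. *)
Definition pent_copies w (c : seq nat) (u v : nat * nat) : nat :=
  if (u.2 < w u.1) && (v.2 < w v.1) then count_mem (u.1, v.1) (arcs c) else 0.

Lemma pent_copies_neq0 w c u v :
  (pent_copies w c u v != 0) =
    [&& u.2 < w u.1, v.2 < w v.1 & (u.1, v.1) \in arcs c].
Proof.
rewrite /pent_copies andbA; case: ifP => //= _.
by rewrite -lt0n -has_count has_pred1.
Qed.

Lemma pentagonal_blown_pentagon : pentagonal (pent_copies (fun=> 5) (iota 0 5)).
Proof.
exists blown_pentagon; first by vm_compute.
pose Q := [seq (x, y) | x <- iota 0 5, y <- iota 0 5].
have mem_Q x y : ((x, y) \in Q) = (x < 5) && (y < 5).
  apply/allpairsP/andP => [[[x' y']] []|[x5 y5]].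
    by rewrite !mem_iota => ? ? [-> ->].
  by exists (x, y); rewrite !mem_iota.
pose L := [seq ((p.1, q.1), (p.2, q.2)) | p <- arcs (iota 0 5), q <- Q].
have mem_L i x j y :
    (((i, x), (j, y)) \in L) = [&& x < 5, y < 5 & (i, j) \in arcs (iota 0 5)].
  apply/allpairsP/and3P => [[[[a b] [c d]] []]|[x5 y5 ij]].
    by rewrite mem_Q => ab /andP[? ?] [-> -> -> ->].
  by exists ((i, j), (x, y)); rewrite mem_Q x5 y5.
have UL : uniq L by vm_compute.
have /permP perm_L : perm_eq (all_arcs blown_pentagon) L by vm_compute.
have Uarcs : uniq (arcs (iota 0 5)) by vm_compute.
(* Forgetting the body of L keeps conversion from unfolding its 250 entries. *)
move: (L) UL mem_L perm_L => {}L UL mem_L perm_L [i x] [j y].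
rewrite perm_L (count_uniq_mem _ UL) mem_L /pent_copies.
rewrite (count_uniq_mem _ Uarcs) andbA /fst /snd.
by case: ifP => // ->.
Qed.

Lemma mem_arcs (V : eqType) (c : seq V) u v :
  (u, v) \in arcs c -> (u \in c) && (v \in c).
Proof.
rewrite mem_cat => /orP[] uv.
  rewrite -(mem_rot 1 c v); move: uv.
  by elim: c (rot 1 c) => [|a c IH] [|b d] //=; rewrite !inE xpair_eqE;
    case/orP=> [/andP[-> ->]//|/IH /andP[-> ->]]; rewrite !orbT.
rewrite andbC -(mem_rot 1 c u); move: uv.
by elim: c (rot 1 c) => [|a c IH] [|b d] //=; rewrite !inE xpair_eqE;
  case/orP=> [/andP[-> ->]//|/IH /andP[-> ->]]; rewrite !orbT.
Qed.

(** All pentagons of weight 5 have the same blow-up up to renaming, by the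
embedding that sends the class [i] to the class of the vertex of rank [i]
in [c]. *)
Lemma pentagonal_pent_copies w c :
  pentagon c -> all (fun v => w v == 5) c -> pentagonal (pent_copies w c).
Proof.
move=> /andP[Uc /eqP sc] /allP w5.
have c_nth : c = map (nth 0 c) (iota 0 5).
  by rewrite -[in LHS](mkseq_nth 0 c) sc.
have nth_inj : {in gtn 5 &, injective (nth 0 c)}.
  by move=> i j i5 j5 /eqP; rewrite nth_uniq ?sc // => /eqP.
have w_nth i : i < 5 -> w (nth 0 c i) = 5.
  by move=> i5; apply/eqP/w5; rewrite mem_nth ?sc.
apply: (@pentagonal_image _ _ [pred u | (u.1 < 5) && (u.2 < 5)]
          (fun u => (nth 0 c u.1, u.2)) _ _ _ _ _ _ pentagonal_blown_pentagon).
- move=> [i x] [j y]; rewrite !inE /= => /andP[i5 _] /andP[j5 _] [ij ->].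
  by rewrite (nth_inj _ _ i5 j5 ij).
- move=> [i x] [j y]; rewrite pent_copies_neq0 => /and3P[x5 y5 /mem_arcs].
  by rewrite !mem_iota !add0n !inE => /andP[/= -> ->]; rewrite x5 y5.
- move=> [i x] [j y]; rewrite !inE => /andP[i5 x5] /andP[j5 y5].
  rewrite /pent_copies !w_nth // x5 y5 [X in arcs X]c_nth arcs_map.
  apply: (count_map_inj_in nth_inj) => // -[a b] /mem_arcs.
  by rewrite !mem_iota.
move=> [v x] [v' y]; rewrite pent_copies_neq0 => /and3P[/= xw yw].
move=> /mem_arcs /andP[vc v'c].
rewrite (eqP (w5 _ vc)) in xw; rewrite (eqP (w5 _ v'c)) in yw.
exists (index v c, x); first by rewrite !inE /= -sc index_mem vc sc.
exists (index v' c, y); first by rewrite !inE /= -sc index_mem v'c sc.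
by rewrite /= !nth_index.
Qed.

(** * Skeletons of complete tripartite graphs *)

Definition K_neighbours n1 n2 n3 u :=
  if u < n1 then iota n1 (n2 + n3)
  else if u < n1 + n2 then iota 0 n1 ++ iota (n1 + n2) n3
  else iota 0 (n1 + n2).

(** A test of exact covering meant for evaluation: it compares sorted
neighbour lists one vertex at a time, which is much cheaper than comparing two
multisets of arcs. *)
Definition covers_K n1 n2 n3 (A : seq (nat * nat)) : bool :=
  all (fun p => p.1 < n1 + n2 + n3) A &&
  all (fun u => sort leq [seq p.2 | p <- A & p.1 == u]
                  == K_neighbours n1 n2 n3 u)
      (iota 0 (n1 + n2 + n3)).

Lemma tripartite_iota n1 n2 n3 u v :
  tripartite (iota 0 n1) (iota n1 n2) (iota (n1 + n2) n3) u v =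
    (u < n1 + n2 + n3) && (v \in K_neighbours n1 n2 n3 u).
Proof.
have pidx x : part_index (iota 0 n1) (iota n1 n2) (iota (n1 + n2) n3) x =
   if x < n1 then 1 else if x < n1 + n2 then 2
   else if x < n1 + n2 + n3 then 3 else 0.
  by rewrite /part_index !mem_iota; repeat case: ifP; lia.
rewrite /tripartite /K_neighbours !pidx.
by repeat (case: ifP); rewrite ?mem_cat ?mem_iota; lia.
Qed.

Lemma covers_KP n1 n2 n3 A : covers_K n1 n2 n3 A ->
  forall u v, count_mem (u, v) A =
    tripartite (iota 0 n1) (iota n1 n2) (iota (n1 + n2) n3) u v.
Proof.
case/andP=> /allP ltA /allP nbrA u v; rewrite tripartite_iota.
have [lt_u|ge_u] := ltnP u (n1 + n2 + n3); last first.
  apply/eqP; rewrite -leqn0 leqNgt -has_count has_pred1.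
  by apply/negP => /ltA; rewrite ltnNge ge_u.
have -> : count_mem (u, v) A = count_mem v [seq p.2 | p <- A & p.1 == u].
  rewrite count_map count_filter; apply: eq_count => -[a b] /=.
  by rewrite xpair_eqE andbC.
have /eqP {nbrA} : sort leq [seq p.2 | p <- A & p.1 == u]
    == K_neighbours n1 n2 n3 u by apply: nbrA; rewrite mem_iota.
move/(congr1 (count_mem v)); rewrite count_sort => ->.
rewrite count_uniq_mem // /K_neighbours.
case: ifP => _; first exact: iota_uniq.
case: ifP => _; last exact: iota_uniq.
rewrite cat_uniq !iota_uniq andbT /=; apply/hasPn => x.
by rewrite !mem_iota; lia.
Qed.

Lemma pentagonal_K_of_pentagons n1 n2 n3 cs :
    all (@pentagon _) cs -> covers_K n1 n2 n3 (all_arcs cs) ->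
  pentagonal_K n1 n2 n3.
Proof. by move=> cs5 /covers_KP; exists cs. Qed.

Definition tripartite_arcs (b : seq nat * seq nat * seq nat) :
    seq (nat * nat) :=
  let: (A, B, C) := b in
  let E := [seq (x, y) | x <- A, y <- B] ++ [seq (x, y) | x <- A, y <- C]
           ++ [seq (x, y) | x <- B, y <- C] in
  E ++ [seq (p.2, p.1) | p <- E].

Lemma count_pairs (A B : seq nat) u v :
  count_mem (u, v) [seq (x, y) | x <- A, y <- B] =
    count_mem u A * count_mem v B.
Proof.
elim: A => [|a A IH] //=; rewrite count_cat IH mulnDl; congr (_ + _).
rewrite count_map; case: eqP => [->|neq] /=.
  by rewrite mul1n; apply: eq_count => y /=; rewrite xpair_eqE eqxx.
rewrite mul0n; apply/eqP; rewrite -leqn0 leqNgt -has_count.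
by apply/hasPn => y _ /=; rewrite xpair_eqE; apply/negP => /andP[/eqP].
Qed.

Lemma count_tripartite_arcs A B C u v : uniq (A ++ B ++ C) ->
  count_mem (u, v) (tripartite_arcs (A, B, C)) = tripartite A B C u v.
Proof.
have swap (E : seq (nat * nat)) :
    count_mem (u, v) [seq (p.2, p.1) | p <- E] = count_mem (v, u) E.
  rewrite count_map; apply: eq_count => -[a b] /=.
  by rewrite !xpair_eqE andbC.
rewrite !cat_uniq has_cat negb_or => /and3P[UA /andP[/hasPn BA /hasPn CA]].
case/and3P=> UB /hasPn CB UC.
have disj x : [&& ~~ ((x \in A) && (x \in B)), ~~ ((x \in A) && (x \in C))
                & ~~ ((x \in B) && (x \in C))].
  apply/and3P; split; apply/negP => /andP[H K].
  - by move/negP: (BA _ K).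
  - by move/negP: (CA _ K).
  by move/negP: (CB _ K).
rewrite /tripartite_arcs count_cat swap !count_cat !count_pairs.
rewrite !count_uniq_mem //.
rewrite /tripartite /part_index; move: (disj u) (disj v).
by case: (u \in A); case: (u \in B); case: (u \in C);
   case: (v \in A); case: (v \in B); case: (v \in C).
Qed.

(** A certificate that the edges of [K_{n1,n2,n3}] split exactly into complete
tripartite blocks, given by their three vertex lists, and pentagons.  A
triangle is a block with singleton parts. *)
Definition skeleton n1 n2 n3 blocks pents : bool :=
  [&& all (fun b => uniq (b.1.1 ++ b.1.2 ++ b.2)) blocks,
      all (@pentagon _) pents
    & covers_K n1 n2 n3
        (flatten (map tripartite_arcs blocks) ++ all_arcs pents)].

(** The reduction step: the blow-up of an exact cover is an exact cover by
blow-ups.  A blown-up block is complete tripartite, its parts having as sizes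
the total weights of the parts of the block. *)
Lemma pentagonal_K_skeleton n1 n2 n3 blocks pents (w : nat -> nat) :
    skeleton n1 n2 n3 blocks pents ->
    (forall b, b \in blocks ->
       pentagonal_K (sumn (map w b.1.1)) (sumn (map w b.1.2))
               (sumn (map w b.2))) ->
    all (all (fun v => w v == 5)) pents ->
  pentagonal_K (sumn (map w (iota 0 n1))) (sumn (map w (iota n1 n2)))
               (sumn (map w (iota (n1 + n2) n3))).
Proof.
case/and3P=> /allP Ublocks /allP pents5 /covers_KP cov blocks_dec /allP w5.
rewrite -!size_copies; apply: pentagonal_K_of_lists.
  by rewrite -!copies_cat uniq_copies // iota3 iota_uniq.
pose f (b : seq nat * seq nat * seq nat) :=
  fun u v : nat * nat =>
    tripartite (copies w b.1.1) (copies w b.1.2) (copies w b.2) u v : nat.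
have decB := @pentagonal_sum _ _ f blocks
  (fun b bt => pentagonal_tripartite_copies (Ublocks b bt) (blocks_dec b bt)).
have decP := @pentagonal_sum _ _ (pent_copies w) pents
  (fun c cp => pentagonal_pent_copies (pents5 c cp) (w5 c cp)).
apply: pentagonal_ext (pentagonal_add decB decP) => u v.
rewrite tripartite_copies /f /pent_copies.
under eq_bigr do rewrite tripartite_copies.
have [uw|uw] := ltnP u.2 (w u.1); last by rewrite /= !big1.
have [vw|vw] := ltnP v.2 (w v.1); last by rewrite /= !big1.
rewrite /= -cov count_cat; congr (_ + _).
  rewrite count_flatten -map_comp sumnE big_map big_seq [RHS]big_seq.
  by apply: eq_bigr => -[[A B] C] /Ublocks /= U; rewrite count_tripartite_arcs.
by rewrite /all_arcs count_flatten -map_comp sumnE big_map.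
Qed.

(** * Decompositions of small complete tripartite graphs *)

Definition fives (s : seq nat) : seq (seq nat) :=
  reshape (nseq (size s %/ 5) 5) s.

(** In the lists [pentagons_r_s_t] the parts of [K_{r,s,t}] are the intervals
of vertices from 0 to [r - 1], from [r] to [r + s - 1], and from [r + s]
onwards. *)
Definition pentagons_3_5_5 : seq (seq nat) := fives [::
   11;5;12;6;0; 2;5;9;0;4; 10;6;11;3;0; 1;5;0;7;10; 4;10;2;9;1; 7;11;2;6;8;
   2;8;5;10;3; 3;8;4;11;1; 7;1;8;0;12; 3;12;2;7;9; 9;4;12;1;6].

Definition pentagons_5_5_5 : seq (seq nat) := fives [::
   9;1;6;3;13; 6;12;8;4;10; 2;6;13;4;5; 7;3;10;2;14; 9;2;13;5;14; 4;7;13;0;14;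
   10;5;3;14;1; 2;11;0;7;12; 11;7;10;9;3; 8;3;12;5;1; 6;14;8;10;0;
   0;5;11;9;12; 8;0;9;4;11; 4;6;11;1;12; 1;7;2;8;13].

Definition pentagons_7_5_5 : seq (seq nat) := fives [::
   15;2;11;13;7; 12;4;13;2;9; 4;8;0;7;16; 11;4;14;2;12; 0;12;3;8;14;
   11;16;0;15;3; 13;3;9;14;10; 13;9;0;10;6; 5;13;1;12;10; 14;3;10;1;7;
   8;13;0;11;1; 15;9;16;2;8; 5;12;7;4;9; 8;16;3;7;6; 1;9;6;11;14;
   16;1;15;4;10; 15;11;5;14;6; 15;10;2;7;5; 5;16;6;12;8].

Definition pentagons_9_5_5 : seq (seq nat) := fives [::
   18;3;15;11;0; 0;13;16;3;14; 0;15;13;6;16; 15;4;11;17;5; 4;13;17;0;10;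
   13;18;10;15;2; 9;2;11;6;18; 14;8;13;3;10; 2;10;6;15;12; 12;1;17;2;16;
   11;5;16;1;14; 4;18;12;6;14; 9;0;12;4;17; 3;11;16;4;9; 7;17;3;12;14;
   5;13;14;2;18; 7;15;8;11;18; 7;10;8;17;12; 8;12;5;14;9; 7;11;1;15;9;
   1;18;8;16;9; 9;6;17;10;5; 1;10;16;7;13].

(** The value 11 is the smallest odd [w] with [25 <= 4 * 15 * w / (15 + w)].
The values 21 and 23 serve the largest sums: with 11, 13, 15 and 25 alone,
three terms miss 57, 59, 67, 69, 71 and 73. *)
Definition pentagons_11_15_25 : seq (seq nat) := fives [::
   17;47;4;50;9; 38;0;26;4;23; 39;6;12;36;22; 8;26;20;43;17; 6;47;12;39;18;
   26;14;34;22;1; 8;23;50;22;49; 6;50;5;35;20; 25;4;35;17;39; 20;28;2;36;0;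
   8;11;44;20;41; 7;22;33;17;49; 4;28;5;46;18; 46;21;30;3;23; 12;32;5;42;7;
   8;28;18;50;14; 23;29;17;46;1; 38;7;32;14;3; 1;33;9;29;20; 27;3;21;41;7;
   34;13;8;37;16; 7;40;6;44;24; 5;20;38;18;48; 36;11;48;17;5; 4;44;16;39;19;
   5;24;40;11;31; 21;28;22;43;7; 30;17;7;36;23; 23;5;27;14;28; 16;43;14;45;8;
   9;34;7;23;32; 21;39;23;9;42; 13;31;8;35;7; 4;45;16;48;13; 21;0;42;12;48;
   32;21;4;42;13; 33;10;48;20;8; 25;45;18;1;31; 18;34;8;40;2; 8;38;4;24;32;
   49;25;42;15;6; 19;50;15;30;0; 24;35;23;0;41; 0;35;21;31;22; 22;27;24;47;9;
   8;27;18;26;22; 22;48;14;38;2; 14;40;21;37;9; 41;17;42;14;6; 29;4;14;44;12;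
   2;32;22;38;15; 6;35;12;43;11; 6;16;41;25;33; 43;6;48;8;24; 15;26;2;30;7;
   45;2;13;35;9; 19;44;0;40;5; 16;28;15;43;10; 12;10;41;23;45; 19;7;48;23;42;
   24;42;22;44;9; 49;15;10;38;24; 37;24;50;7;18; 16;26;12;41;9; 30;16;4;39;1;
   20;37;1;17;31; 19;40;18;49;2; 0;12;31;24;48; 4;37;6;23;34; 45;1;48;2;21;
   4;33;21;6;32; 17;45;11;32;0; 17;40;20;27;4; 5;12;33;13;49; 29;7;45;5;11;
   22;4;49;19;37; 17;27;21;43;2; 10;36;14;35;11; 23;47;21;1;40; 6;42;2;29;24;
   46;24;34;11;4; 34;12;4;41;15; 32;17;6;45;10; 0;15;48;9;28; 2;46;10;27;16;
   9;11;46;25;40; 18;3;28;1;29; 19;43;9;18;35; 13;28;19;6;30; 13;44;8;21;29;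
   1;32;20;50;12; 23;26;11;42;10; 7;26;24;2;39; 10;35;22;29;25; 12;37;14;2;27;
   37;2;12;28;10; 31;10;18;42;3; 15;27;23;2;33; 31;14;33;20;9; 31;16;29;14;7;
   0;25;37;23;31; 45;20;34;0;24; 7;33;3;24;28; 9;30;19;38;12; 25;43;3;37;7;
   47;3;48;25;8; 16;7;11;47;0; 9;46;12;40;13; 10;17;38;13;26; 36;16;50;10;24;
   33;24;1;41;18; 8;43;13;27;19; 15;46;8;36;9; 25;27;9;26;5; 15;36;20;7;47;
   6;46;0;11;28; 13;6;31;18;36; 18;47;22;41;5; 3;36;25;28;17; 3;34;6;27;11;
   3;41;11;33;19; 13;0;39;11;37; 8;18;43;0;50; 36;17;50;13;1; 4;36;19;32;15;
   43;4;48;19;1; 5;43;23;44;15; 15;37;0;27;1; 35;2;47;14;1; 1;16;32;3;49;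
   20;49;0;18;30; 11;30;4;31;2; 1;34;2;20;42; 38;11;50;25;1; 21;50;1;11;49;
   38;6;36;21;9; 38;16;49;9;25; 44;2;25;26;21; 47;10;21;38;5; 12;30;25;35;3;
   8;42;16;35;15; 30;8;12;49;10; 29;8;39;9;19; 15;29;6;22;40; 3;26;19;31;15;
   5;13;39;24;30; 45;22;5;39;15; 0;33;23;49;14; 10;39;14;30;22; 29;5;33;16;3;
   45;19;46;22;3; 3;50;2;41;13; 3;44;18;32;25; 20;39;3;40;10; 13;45;0;29;10;
   20;3;46;13;47; 16;40;4;20;46; 10;19;47;1;44; 17;37;5;21;34; 25;6;26;17;44;
   14;46;7;44;5; 5;16;47;25;34; 41;14;10;34;19].

Definition pentagons_13_15_25 : seq (seq nat) := fives [::
   41;2;14;29;15; 27;36;2;34;5; 22;47;12;19;44; 19;8;28;18;34; 21;35;23;41;4;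
   10;28;21;37;27; 25;49;14;51;9; 34;26;9;47;24; 8;40;9;52;20; 49;11;27;32;21;
   14;44;3;43;1; 0;38;24;46;26; 44;21;8;48;16; 30;22;4;27;9; 42;17;48;23;1;
   18;37;12;26;32; 14;0;42;21;39; 47;27;41;19;2; 1;46;4;39;19; 18;38;10;50;3;
   23;10;30;27;29; 27;42;19;30;12; 6;19;37;15;32; 45;12;39;11;14;
   16;45;27;46;6; 25;2;32;20;40; 11;16;37;26;31; 52;14;4;33;23;
   22;49;19;47;11; 28;25;7;31;14; 50;18;29;5;14; 4;40;14;10;45; 28;5;13;29;9;
   13;38;14;32;9; 30;25;32;8;14; 9;44;8;39;24; 43;22;5;38;27; 43;12;36;7;14;
   14;47;5;17;35; 26;48;27;49;4; 18;9;33;27;7; 9;14;34;1;15; 28;24;1;32;4;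
   26;1;49;0;50; 15;40;17;43;0; 20;33;12;42;10; 13;32;24;41;11; 29;7;28;2;26;
   24;37;17;44;4; 17;39;10;32;7; 2;48;0;35;22; 0;31;6;27;44; 1;47;26;38;17;
   22;32;12;29;3; 15;47;4;30;6; 6;36;1;45;13; 49;20;6;33;17; 45;6;47;0;17;
   34;9;38;25;6; 17;2;30;1;31; 2;16;46;13;33; 35;12;44;20;3; 8;17;28;27;34;
   23;31;3;37;7; 36;8;27;52;13; 8;50;7;43;26; 8;35;9;46;15; 39;26;33;0;13;
   29;6;49;16;4; 44;18;5;30;26; 1;37;22;52;25; 35;19;7;52;26; 20;37;6;40;5;
   36;16;33;19;4; 40;19;32;17;12; 39;22;12;52;5; 11;19;52;8;37; 42;18;4;34;25;
   51;11;26;49;18; 24;44;23;30;7; 10;37;0;24;36; 12;14;36;19;51; 42;23;6;51;7;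
   18;46;7;49;8; 46;0;16;29;21; 28;15;33;14;3; 11;23;46;20;28; 26;40;27;35;7;
   5;35;20;45;25; 18;33;1;41;12; 0;20;31;21;52; 45;21;12;49;5; 4;43;20;48;15;
   12;15;51;22;46; 23;32;5;50;4; 26;36;18;43;5; 24;45;15;7;40; 11;48;21;6;35;
   4;25;47;7;48; 41;14;46;5;21; 26;51;4;20;41; 23;47;8;29;0; 48;14;42;26;6;
   38;23;50;17;4; 13;34;0;40;3; 10;21;33;11;52; 23;37;4;13;51; 51;24;5;48;10;
   39;0;22;29;2; 10;47;3;52;15; 45;8;51;3;26; 41;0;28;26;10; 17;29;24;52;6;
   2;24;30;17;52; 52;4;42;6;18; 19;28;6;39;9; 10;29;19;45;22; 11;38;15;36;21;
   18;47;20;29;1; 2;35;4;31;18; 35;1;51;0;18; 38;16;28;23;2; 22;33;5;16;50;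
   10;35;13;48;19; 9;22;38;6;41; 22;40;18;10;31; 11;50;19;46;25;
   5;44;10;43;19; 7;41;13;28;22; 1;22;36;9;16; 21;7;45;18;30; 9;50;15;34;17;
   20;11;30;16;51; 42;11;46;2;13; 12;13;7;33;24; 17;41;22;48;3; 39;18;48;1;27;
   20;36;0;27;2; 45;2;51;5;23; 39;25;10;34;7; 20;9;42;8;38; 7;16;52;1;44;
   0;45;11;29;25; 38;19;0;32;3; 21;38;12;28;1; 50;20;7;38;1; 13;47;21;0;30;
   44;15;49;10;13; 20;1;39;15;30; 23;36;25;48;9; 3;36;17;51;27; 3;30;8;22;34;
   31;16;39;3;25; 3;41;25;51;21; 2;42;22;6;50; 21;40;1;13;50; 49;3;19;31;2;
   34;21;2;44;11; 11;24;49;13;40; 2;40;16;35;15; 43;16;41;18;11;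
   12;31;27;50;25; 37;2;43;15;5; 12;50;24;42;20; 5;36;11;15;42; 23;34;16;42;3;
   31;5;41;8;13; 9;21;43;13;37; 25;37;14;6;43; 31;15;3;45;9; 23;39;20;34;12;
   8;43;9;49;23; 8;16;12;48;24; 24;43;23;40;10; 35;24;6;44;25; 16;32;11;17;10;
   46;17;47;16;3; 24;3;33;8;31; 33;25;8;46;10].

Definition pentagons_21_15_25 : seq (seq nat) := fives [::
   14;36;9;56;31; 42;23;5;43;8; 25;12;40;14;57; 19;48;3;27;56; 40;16;25;59;24;
   26;51;15;29;12; 5;49;3;24;44; 46;8;21;41;14; 40;25;4;42;20; 30;4;32;9;43;
   47;25;49;8;34; 12;35;44;15;60; 53;12;34;0;31; 21;51;20;52;7; 0;29;56;3;46;
   55;16;48;0;24; 36;34;44;8;25; 41;35;9;55;12; 43;25;48;31;20;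
   36;27;19;58;18; 53;9;52;26;7; 26;4;39;13;50; 43;27;15;58;3; 48;34;9;57;32;
   20;55;8;33;39; 31;16;47;28;39; 16;27;52;3;42; 39;3;45;35;14; 45;8;58;22;17;
   33;60;5;39;10; 32;6;41;9;60; 53;6;35;60;25; 6;56;28;16;43; 58;0;23;46;29;
   31;38;25;39;1; 11;31;45;34;40; 39;0;40;3;26; 12;49;33;9;27; 17;34;51;7;58;
   8;39;17;38;32; 53;20;41;33;16; 31;46;18;49;7; 54;33;2;42;7; 33;0;60;23;53;
   9;47;4;40;29; 53;3;28;55;1; 0;25;3;54;32; 10;57;23;4;21; 20;54;34;38;26;
   2;26;43;28;58; 57;0;30;7;33; 21;54;13;26;19; 27;0;41;15;37; 22;47;6;27;49;
   47;11;25;52;0; 25;14;38;7;56; 26;36;2;46;9; 59;0;51;10;31; 22;37;16;32;55;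
   30;38;29;55;6; 51;24;10;54;11; 18;33;48;7;47; 28;11;41;7;59;
   19;55;10;29;52; 16;24;46;10;41; 0;42;29;43;21; 26;14;52;18;53;
   29;17;53;34;41; 6;51;29;36;24; 51;25;19;41;13; 42;11;50;31;9;
   28;36;7;35;42; 53;13;46;33;4; 19;38;18;21;46; 23;50;9;25;6; 21;56;14;51;2;
   58;31;3;47;12; 60;1;58;13;28; 19;44;29;20;57; 47;24;57;6;33; 8;47;29;6;40;
   54;17;55;14;22; 38;1;34;43;2; 28;20;38;33;51; 1;30;52;11;33; 52;23;7;50;15;
   21;48;12;24;45; 50;33;20;59;27; 24;14;53;28;15; 40;28;12;46;15;
   16;34;49;15;23; 34;60;24;17;46; 1;42;33;19;51; 15;22;52;12;42;
   8;22;36;17;50; 38;12;43;13;24; 30;55;27;44;17; 23;8;56;13;38;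
   40;33;44;1;21; 39;22;11;43;15; 7;57;30;42;24; 45;16;58;27;11;
   19;50;16;56;34; 24;54;16;26;11; 43;24;41;28;1; 30;19;29;14;60;
   23;56;22;12;37; 11;53;15;25;37; 22;20;36;33;43; 21;37;13;55;11;
   56;4;27;48;24; 34;58;5;57;11; 34;50;25;54;6; 38;22;7;28;10; 36;15;32;43;31;
   29;37;1;27;39; 29;11;58;14;49; 23;39;11;60;17; 53;32;10;50;29;
   24;8;51;3;50; 13;44;25;42;22; 42;19;54;5;27; 31;8;38;6;44; 29;4;49;1;59;
   13;40;9;30;36; 36;16;22;1;32; 35;38;9;24;58; 13;29;7;45;27; 18;40;7;43;35;
   30;40;17;43;10; 41;1;35;57;2; 36;12;30;54;1; 21;50;20;23;58; 36;8;29;54;0;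
   6;39;30;11;36; 44;4;58;6;22; 37;4;43;18;34; 14;48;6;60;27; 26;42;5;48;1;
   46;27;53;8;28; 49;10;56;35;20; 60;13;23;41;4; 6;50;18;42;31; 26;6;49;30;41;
   50;28;6;52;1; 44;18;51;30;20; 53;24;20;56;5; 24;2;44;10;52; 22;50;14;34;59;
   26;37;33;12;45; 29;45;32;56;1; 13;59;12;50;30; 0;50;32;14;45;
   1;40;26;58;25; 3;44;0;49;21; 1;24;5;30;46; 23;45;1;47;14; 14;42;21;15;30;
   32;47;5;35;46; 37;20;45;33;3; 23;44;14;21;9; 53;2;29;3;30; 24;19;22;9;49;
   26;48;23;1;57; 40;31;49;13;32; 45;13;57;31;5; 10;48;4;24;37; 32;17;57;3;41;
   48;8;26;44;30; 37;9;58;30;18; 9;48;22;18;45; 23;43;0;55;18; 13;42;32;18;31;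
   59;32;7;37;14; 25;46;20;48;13; 41;25;20;47;31; 51;5;25;45;4; 35;0;53;19;47;
   35;40;23;47;2; 57;15;45;2;34; 52;13;21;57;8; 7;46;26;54;27; 21;38;5;59;16;
   27;18;60;10;40; 60;20;34;55;7; 29;18;41;27;57; 7;44;21;5;34; 16;44;28;5;29;
   17;21;60;29;48; 51;22;5;46;16; 31;52;28;57;4; 28;4;46;11;48;
   17;27;51;12;31; 39;18;48;15;35; 31;60;22;40;19; 54;31;37;0;28;
   4;52;34;13;35; 19;39;12;23;59; 8;54;4;59;35; 19;28;17;49;35;
   32;19;37;17;51; 17;41;8;30;47; 59;9;28;14;33; 15;34;42;17;33;
   15;47;13;33;56; 56;0;22;57;18; 51;9;44;11;23; 2;48;35;51;31;
   59;17;56;26;15; 26;0;38;15;55; 55;5;40;2;25; 23;19;43;14;54; 18;24;39;7;25;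
   10;25;17;26;59; 38;27;10;36;3; 28;38;11;59;18; 23;49;28;45;10;
   21;36;23;3;55; 2;55;31;15;54; 35;55;23;2;52; 54;35;10;26;18; 5;36;4;55;33;
   32;5;52;33;58; 20;58;10;47;21; 39;2;27;20;32; 39;16;38;4;34; 21;39;9;54;12;
   52;16;57;12;32; 53;21;52;17;35; 42;10;22;45;6; 22;53;10;34;3; 2;22;46;6;59;
   32;44;12;56;2; 5;41;22;4;50; 35;50;2;28;37; 19;45;30;16;60; 60;8;27;47;26;
   49;26;5;37;2; 11;49;19;36;35; 32;49;16;35;3; 30;56;11;32;37; 2;30;59;3;60;
   59;21;6;37;8].

Definition pentagons_23_15_25 : seq (seq nat) := fives [::
   5;38;17;27;43; 51;27;3;39;9; 27;21;54;14;50; 17;34;1;27;47; 23;43;17;39;6;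
   25;45;27;7;39; 29;48;9;46;12; 4;32;56;13;55; 37;55;21;33;58;
   32;44;21;43;16; 30;42;16;60;12; 6;56;3;49;32; 45;10;37;8;30; 55;3;31;19;23;
   31;22;52;6;47; 55;7;35;56;2; 13;35;51;23;42; 44;28;55;6;29; 51;0;60;17;29;
   1;57;25;53;36; 41;0;42;22;35; 30;3;38;4;57; 47;19;51;34;11; 55;12;40;19;26;
   38;18;43;33;16; 61;37;3;41;17; 4;50;37;9;33; 23;54;33;11;58; 14;41;9;27;57;
   21;35;58;12;61; 11;46;2;48;23; 44;20;43;32;19; 59;23;5;50;15;
   29;3;57;35;60; 58;14;45;37;22; 14;26;13;25;47; 26;22;54;18;41;
   6;57;7;50;24; 39;10;53;9;26; 42;10;34;52;1; 14;25;51;8;38; 32;46;37;44;14;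
   22;23;57;28;46; 47;23;53;27;22; 7;41;16;37;62; 49;17;37;54;35;
   23;3;44;33;60; 59;0;32;38;29; 48;1;38;6;26; 34;2;45;8;53; 59;3;34;57;12;
   55;32;21;57;16; 7;33;56;19;60; 48;11;60;37;18; 3;54;6;48;32; 50;0;48;33;22;
   37;43;10;27;48; 32;40;28;52;11; 0;62;19;42;25; 47;15;49;20;37;
   12;35;59;27;49; 23;56;22;59;10; 5;51;28;21;48; 24;44;22;34;59;
   15;23;46;16;27; 7;59;18;52;24; 35;50;25;52;2; 26;1;54;5;59; 46;36;11;38;0;
   41;37;4;58;34; 4;43;26;20;25; 18;32;50;16;47; 1;49;18;23;44; 23;7;40;22;62;
   45;32;10;51;16; 29;56;14;28;9; 0;39;5;46;29; 57;37;1;59;19; 41;33;0;58;10;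
   34;16;61;11;39; 27;52;36;57;13; 59;37;56;10;28; 0;53;29;45;31;
   19;25;3;58;28; 7;36;60;15;53; 38;35;39;18;33; 60;9;61;33;1; 23;0;43;19;50;
   61;24;10;55;35; 37;0;45;1;39; 33;52;9;24;62; 33;39;19;54;12; 9;44;35;3;47;
   37;19;55;34;6; 55;0;34;61;29; 11;44;6;49;24; 37;21;59;30;11; 19;61;2;53;33;
   19;49;2;26;46; 53;1;55;22;32; 25;46;31;43;1; 19;24;51;37;53;
   17;53;11;29;50; 57;31;18;40;33; 2;44;16;40;30; 22;51;20;32;39;
   0;27;2;33;47; 36;19;35;10;54; 27;6;25;58;19; 42;37;5;55;17; 41;32;60;24;4;
   14;36;0;24;39; 44;18;26;61;13; 18;34;42;21;45; 47;30;14;46;7;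
   47;29;8;41;13; 38;2;29;13;23; 16;25;44;7;56; 7;30;51;2;42; 19;45;17;54;29;
   57;29;39;15;32; 24;47;1;29;18; 18;61;32;1;35; 23;14;34;60;21;
   25;38;19;30;5; 5;56;0;52;35; 54;8;33;42;11; 27;41;19;52;14; 5;27;39;21;40;
   24;40;29;41;5; 16;35;40;14;49; 11;62;3;26;50; 8;57;17;44;27; 4;61;6;58;27;
   9;35;11;41;25; 10;49;33;20;36; 12;45;9;57;26; 36;17;46;10;61;
   23;52;8;26;17; 23;41;1;46;4; 8;36;16;62;35; 61;23;2;50;1; 12;23;39;8;50;
   55;8;47;4;31; 62;27;18;55;14; 7;61;14;24;43; 9;54;15;29;43; 2;57;18;50;28;
   50;33;15;45;20; 48;13;50;34;12; 36;58;13;46;3; 7;48;24;21;25;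
   36;43;8;25;40; 14;51;18;42;29; 53;20;55;33;14; 25;15;37;14;43;
   37;38;26;53;12; 52;29;7;49;37; 50;3;40;6;36; 8;59;32;12;28; 32;17;28;54;13;
   12;42;6;28;43; 62;28;0;61;25; 32;9;34;15;52; 21;49;0;54;30; 34;43;6;62;21;
   7;34;54;32;51; 11;51;31;10;25; 31;52;21;58;9; 7;26;45;11;31; 50;21;26;42;9;
   59;9;30;46;6; 6;35;14;59;31; 12;52;7;45;36; 17;24;53;30;62; 31;48;36;59;17;
   14;31;61;22;48; 8;32;42;14;60; 30;17;48;8;49; 13;43;11;55;36;
   13;38;36;41;30; 49;25;22;60;5; 53;21;29;49;28; 28;22;41;31;60;
   30;43;2;39;16; 4;48;25;55;30; 5;53;6;50;31; 20;59;16;52;30; 15;30;50;10;44;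
   4;44;8;23;40; 40;8;31;38;27; 62;4;54;24;2; 15;58;20;39;28; 12;44;5;61;27;
   62;12;51;13;34; 9;55;24;1;23; 9;62;20;23;49; 15;43;22;24;57;
   48;34;20;57;10; 62;32;5;33;10; 40;10;60;2;31; 45;4;51;6;33; 40;0;30;48;15;
   59;33;17;40;11; 26;15;55;27;11; 13;59;25;2;40; 39;36;9;56;12;
   24;42;31;39;13; 33;51;26;60;3; 52;20;46;33;13; 4;53;13;45;34;
   11;56;31;13;49; 28;11;57;22;38; 51;1;28;45;3; 49;22;36;56;34; 4;42;3;48;35;
   4;59;2;47;28; 21;51;17;35;47; 56;4;26;54;25; 38;21;36;47;12; 47;32;2;41;20;
   26;10;29;20;56; 40;20;48;19;34; 17;56;28;3;52; 18;58;17;25;60;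
   47;34;44;0;26; 1;30;44;26;40; 4;49;31;44;36; 10;30;60;4;52; 28;5;52;26;16;
   7;37;40;9;38; 38;10;47;5;34; 15;38;30;6;41; 54;2;58;32;7; 20;54;16;48;28;
   18;25;12;41;28; 27;60;13;28;42; 8;42;20;27;46; 46;34;8;56;18;
   1;62;18;30;56; 21;56;27;54;31; 61;8;24;56;15; 24;41;21;46;15;
   61;20;35;43;3; 58;7;28;61;30; 29;4;39;30;22; 31;15;36;18;53; 24;20;60;6;45;
   58;1;31;12;24; 16;23;45;22;53; 31;20;38;24;16; 62;31;58;16;29;
   53;3;24;46;35; 36;51;15;35;42; 45;35;0;57;5; 36;2;37;13;62; 26;62;15;42;5;
   5;36;49;26;58; 62;8;58;29;5].

Lemma pentagonal_K_w55 w : w \in [:: 3; 5; 7; 9] -> pentagonal_K w 5 5.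
Proof.
rewrite !inE => /or4P[] /eqP->.
- by apply: (@pentagonal_K_of_pentagons _ _ _ pentagons_3_5_5); vm_compute.
- by apply: (@pentagonal_K_of_pentagons _ _ _ pentagons_5_5_5); vm_compute.
- by apply: (@pentagonal_K_of_pentagons _ _ _ pentagons_7_5_5); vm_compute.
by apply: (@pentagonal_K_of_pentagons _ _ _ pentagons_9_5_5); vm_compute.
Qed.

(** * Cyclic skeletons *)

(** The classes of the first part have indices below [k + m], and the other two
parts have [n] classes each.  The class [g < k] is joined by triangles to the
pairs of classes [(i, i + g)] modulo [n], that is, to the pairs of
difference [g]. *)
Definition cyclic_triangles n k m : seq (seq nat * seq nat * seq nat) :=
  [seq ([:: g], [:: k + m + i], [:: k + m + n + (i + g) %% n])
    | g <- iota 0 k, i <- iota 0 n].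

(** The class [k + j] takes up the three differences [d], [d + 1], [d + 2],
where [d = k + 3 * j].  They form paths [s_i, t_(i+d), s_(i-1), t_(i+d+1)] of
successive differences [d, d + 1, d + 2], and both ends of the path run once
through all classes as [i] does.  So closing the paths up at the class [k + j]
uses each of its edges once. *)
Definition cyclic_pentagons n k m : seq (seq nat) :=
  let s i := k + m + i %% n in
  let t i := k + m + n + i %% n in
  [seq (let d := k + 3 * j in
        [:: k + j; s i; t (i + d); s (i + n.-1); t (i + d.+1)])
    | j <- iota 0 m, i <- iota 0 n].

Definition cyclic_skeleton n k m : bool :=
  skeleton (k + m) n n (cyclic_triangles n k m) (cyclic_pentagons n k m).

Lemma sumn_map_const (w : nat -> nat) c L :
  {in L, forall v, w v = c} -> sumn (map w L) = c * size L.
Proof.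
elim: L => [|v L IH] wL; first by rewrite muln0.
rewrite /= mulnS wL ?mem_head // IH // => u uL.
by apply: wL; rewrite inE uL orbT.
Qed.

(** A cyclic skeleton exists for [n = k + 3 * m]: the [n] differences are shared
out one to each class on triangles, three to each class on pentagons.  Pentagons
pin the weights of all the classes they meet to 5, so the weights can vary only
on the first [k] classes, where [K_{w,5,5}] is what has to be decomposed. *)
Lemma pentagonal_K_cyclic n k m wr :
    cyclic_skeleton n k m -> size wr = k ->
    all (fun x => x \in [:: 3; 5; 7; 9]) wr ->
  pentagonal_K (sumn wr + 5 * m) (5 * n) (5 * n).
Proof.
move=> sk szk /allP wrP; rewrite -{k}szk in sk; pose w := nth 5 wr.
have w5 v : size wr <= v -> w v = 5 by exact: nth_default.
have := @pentagonal_K_skeleton _ _ _ _ _ w sk.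
rewrite iotaD map_cat sumn_cat map_nth_iota0 // take_size.
have w5' v : w (size wr + v) = 5 by rewrite w5 ?leq_addr.
have sum5 x y : size wr <= x -> sumn (map w (iota x y)) = 5 * y.
  move=> ge_x; rewrite (@sumn_map_const _ 5) ?size_iota // => v.
  by rewrite mem_iota => ?; apply: w5; lia.
rewrite !sum5; [|lia..].
apply.
  move=> _ /allpairsP[[g i] [+ _ ->]] /=; rewrite mem_iota => /andP[_ lt_g].
  by rewrite -!addnA !w5' !addn0; apply/pentagonal_K_w55/wrP/mem_nth.
apply/allP => _ /allpairsP[[j i] [_ _ ->]] /=.
by rewrite -!addnA !w5'.
Qed.

(** * Blocks with parts of sizes 15 and 25 *)

Lemma cyclic_skeleton_3 : cyclic_skeleton 3 3 0.
Proof. by vm_compute. Qed.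

Lemma cyclic_skeleton_5 : cyclic_skeleton 5 5 0 && cyclic_skeleton 5 2 1.
Proof. by vm_compute. Qed.

Lemma pentagonal_K_w_15_15 w :
  w \in [:: 11; 13; 15; 21; 23; 25] -> pentagonal_K w 15 15.
Proof.
have cyc wr := @pentagonal_K_cyclic 3 3 0 wr cyclic_skeleton_3.
rewrite !inE => /orP[/eqP->|/orP[/eqP->|/or4P[]/eqP->]].
- exact: (cyc [:: 3; 3; 5]).
- exact: (cyc [:: 3; 3; 7]).
- exact: (cyc [:: 5; 5; 5]).
- exact: (cyc [:: 7; 7; 7]).
- exact: (cyc [:: 7; 7; 9]).
exact: (cyc [:: 7; 9; 9]).
Qed.

Lemma pentagonal_K_w_25_25 w :
  w \in [:: 11; 13; 15; 21; 23; 25] -> pentagonal_K w 25 25.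
Proof.
have /andP[sk550 sk521] := cyclic_skeleton_5.
have cyc5 wr := @pentagonal_K_cyclic 5 5 0 wr sk550.
have cyc2 wr := @pentagonal_K_cyclic 5 2 1 wr sk521.
rewrite !inE => /orP[/eqP->|/orP[/eqP->|/or4P[]/eqP->]].
- exact: (cyc2 [:: 3; 3]).
- exact: (cyc2 [:: 3; 5]).
- exact: (cyc5 [:: 3; 3; 3; 3; 3]).
- exact: (cyc5 [:: 3; 3; 5; 5; 5]).
- exact: (cyc5 [:: 3; 5; 5; 5; 5]).
exact: (cyc5 [:: 5; 5; 5; 5; 5]).
Qed.

(** For [w = 15] and [w = 25] two parts are equal, and [K_{25,15,15}] and
[K_{15,25,25}] come from cyclic skeletons. *)
Lemma pentagonal_K_w_15_25 w :
  w \in [:: 11; 13; 15; 21; 23; 25] -> pentagonal_K w 15 25.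
Proof.
rewrite !inE => /orP[/eqP->|/orP[/eqP->|/or4P[]/eqP->]].
- by apply: (@pentagonal_K_of_pentagons _ _ _ pentagons_11_15_25); vm_compute.
- by apply: (@pentagonal_K_of_pentagons _ _ _ pentagons_13_15_25); vm_compute.
- by apply/pentagonal_K_swap23/pentagonal_K_swap12/pentagonal_K_w_15_15.
- by apply: (@pentagonal_K_of_pentagons _ _ _ pentagons_21_15_25); vm_compute.
- by apply: (@pentagonal_K_of_pentagons _ _ _ pentagons_23_15_25); vm_compute.
by apply/pentagonal_K_swap12/pentagonal_K_w_25_25.
Qed.

Lemma pentagonal_K_block w x y :
    w \in [:: 11; 13; 15; 21; 23; 25] ->
    x \in [:: 15; 25] -> y \in [:: 15; 25] ->
  pentagonal_K w x y.
Proof.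
move=> wD; rewrite !inE => /orP[]/eqP-> /orP[]/eqP->.
- exact: pentagonal_K_w_15_15.
- exact: pentagonal_K_w_15_25.
- exact/pentagonal_K_swap23/pentagonal_K_w_15_25.
exact: pentagonal_K_w_25_25.
Qed.

(** The nine triangles of the Latin square of order 3 are blown up with weights
that vary in all three parts. *)
Lemma pentagonal_K_latin3 (X Y Z : seq nat) :
    size X = 3 -> size Y = 3 -> size Z = 3 ->
    (forall x y z, x \in X -> y \in Y -> z \in Z -> pentagonal_K x y z) ->
  pentagonal_K (sumn X) (sumn Y) (sumn Z).
Proof.
move=> sX sY sZ XYZ.
have :=
  @pentagonal_K_skeleton _ _ _ _ _ (nth 0 (X ++ Y ++ Z)) cyclic_skeleton_3.
move: X sX Y sY Z sZ XYZ => [|x0 [|x1 [|x2 []]]] // _ [|y0 [|y1 [|y2 []]]] // _.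
move=> [|z0 [|z1 [|z2 []]]] // _ XYZ; apply=> // b.
rewrite (_ : cyclic_triangles 3 3 0 = [seq ([:: g], [:: 3 + i],
    [:: 6 + (i + g) %% 3]) | g <- [:: 0; 1; 2], i <- [:: 0; 1; 2]]) //.
move=> /allpairsP[[g i] [+ + ->]]; rewrite !inE.
by case/or3P=> /eqP /= -> /or3P[]/eqP /= ->; rewrite /= !addn0;
   apply: XYZ; rewrite !inE eqxx ?orbT.
Qed.

(** * The case of r at least 33 *)

Lemma odd_sum3 r : odd r -> 33 <= r <= 75 ->
  exists X : seq nat, [/\ size X = 3, sumn X = r
                        & {subset X <= [:: 11; 13; 15; 21; 23; 25]}].
Proof.
pose D := [:: 11; 13; 15; 21; 23; 25].
pose S := [seq [:: p; q] | p <- D, q <- D].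
move=> odd_r r_range.
have /hasP[w wD /hasP[pq pqS /eqP sum_r]] :
    has (fun w => has (fun pq => w + sumn pq == r) S) D.
  have := isT : all (fun r => odd r ==>
    has (fun w => has (fun pq => w + sumn pq == r) S) D) (iota 33 43).
  by move/allP/(_ r); rewrite mem_iota odd_r; apply; lia.
exists (w :: pq); split=> //.
  by case/allpairsP: pqS => -[p q] [_ _ ->].
move=> v; rewrite inE => /orP[/eqP->//|].
case/allpairsP: pqS => -[p q] [pD qD ->].
by rewrite inE mem_seq1 => /orP[]/eqP->.
Qed.

Lemma sum3_15_25 s : s \in [:: 45; 55; 65; 75] ->
  exists X : seq nat, [/\ size X = 3, sumn X = s & {subset X <= [:: 15; 25]}].
Proof.
rewrite !inE => /or4P[] /eqP->.
- by exists [:: 15; 15; 15]; split=> // x; rewrite !inE => /or3P[]->.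
- exists [:: 15; 15; 25]; split=> // x; rewrite !inE.
  by case/or3P=> ->; rewrite ?orbT.
- exists [:: 15; 25; 25]; split=> // x; rewrite !inE.
  by case/or3P=> ->; rewrite ?orbT.
exists [:: 25; 25; 25]; split=> // x; rewrite !inE.
by case/or3P=> ->; rewrite ?orbT.
Qed.

Lemma pentagonal_K_33_75 r s t : odd r -> 33 <= r <= 75 ->
    s \in [:: 45; 55; 65; 75] -> t \in [:: 45; 55; 65; 75] ->
  pentagonal_K r s t.
Proof.
move=> odd_r /(odd_sum3 odd_r)[X [sX <- XD]] /sum3_15_25[Y [sY <- YD]].
move=> /sum3_15_25[Z [sZ <- ZD]].
apply: pentagonal_K_latin3 => // x y z xX yY zZ.
by apply: pentagonal_K_block; [apply: XD|apply: YD|apply: ZD].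
Qed.

(** * The case of r equal to 31 *)

Lemma pentagonal_K_31_diag s : s \in [:: 45; 55; 65; 75] -> pentagonal_K 31 s s.
Proof.
rewrite !inE => /or4P[] /eqP->.
- by apply: (@pentagonal_K_cyclic 9 9 0 [:: 3; 3; 3; 3; 3; 3; 3; 5; 5]);
    vm_compute.
- by apply: (@pentagonal_K_cyclic 11 5 2 [:: 3; 3; 5; 5; 5]); vm_compute.
- by apply: (@pentagonal_K_cyclic 13 4 3 [:: 3; 3; 3; 7]); vm_compute.
by apply: (@pentagonal_K_cyclic 15 3 4 [:: 3; 3; 5]); vm_compute.
Qed.

Definition vertex_block (p : nat * nat * nat) : seq nat * seq nat * seq nat :=
  ([:: p.1.1], [:: p.1.2], [:: p.2]).

(** In the skeletons for [r = 31] the vertex 0 is the class of size 11, the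
vertices 1 to 4 are the other classes of the first part, and the vertices from
5 onwards are the classes of the second and then of the third part, all of size
5.  Both these sequences are cut into three intervals, of sizes [x0, x1, x2] and
[y0, y1, y2]; the vertex 0 is joined to the pairs of corresponding intervals. *)
Definition diagonal_blocks x0 x1 x2 y0 y1 y2 :=
  let a := x0 + x1 + x2 in
  [:: ([:: 0], iota 5 x0, iota (5 + a) y0);
      ([:: 0], iota (5 + x0) x1, iota (5 + a + y0) y1);
      ([:: 0], iota (5 + x0 + x1) x2, iota (5 + a + y0 + y1) y2)].

(** The intervals of 3 or 5 classes have total weight 15 or 25, so the diagonal
blocks blow up to graphs [K_{11,x,y}] with [x, y] in [15, 25].  The vertex 0 is
kept out of the other triangles and of the pentagons because its weight
is 11. *)
Lemma pentagonal_K_31_skeleton x0 x1 x2 y0 y1 y2 triangles pents :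
    all (fun z => z \in [:: 3; 5]) [:: x0; x1; x2; y0; y1; y2] ->
    all (fun p => [&& p.1.1 != 0, p.1.2 != 0 & p.2 != 0]) triangles ->
    all (all (fun v => v != 0)) pents ->
    skeleton 5 (x0 + x1 + x2) (y0 + y1 + y2)
      (diagonal_blocks x0 x1 x2 y0 y1 y2 ++ map vertex_block triangles) pents ->
  pentagonal_K 31 (5 * (x0 + x1 + x2)) (5 * (y0 + y1 + y2)).
Proof.
move=> sizes /allP trs0 /allP pents0 sk; pose w v := if v == 0 then 11 else 5.
have sum5 x y : 0 < x -> sumn (map w (iota x y)) = 5 * y.
  move=> x_gt0; rewrite (@sumn_map_const _ 5) ?size_iota // => v.
  by rewrite mem_iota /w; case: v => //; lia.
have := @pentagonal_K_skeleton _ _ _ _ _ w sk.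
rewrite (sum5 5) // (sum5 (5 + _)) // -[sumn _]/31.
apply; last first.
  apply/allP => c /pents0 /allP c0; apply/allP => v /c0.
  by rewrite /w => /negbTE->.
have block z z' : z \in [:: 3; 5] -> z' \in [:: 3; 5] ->
    pentagonal_K 11 (5 * z) (5 * z').
  move=> zP z'P; apply: pentagonal_K_block => //.
    by move: zP; rewrite !inE => /orP[]/eqP->.
  by move: z'P; rewrite !inE => /orP[]/eqP->.
case/and5P: sizes => X0 X1 X2 Y0 /andP[Y1 /andP[Y2 _]].
move=> b; rewrite mem_cat => /orP[|/mapP[[[p q] z] /trs0 pq0 ->]].
  by rewrite !inE => /or3P[]/eqP->; rewrite !sum5 //; apply: block.
case/and3P: pq0; rewrite /= /w => /negbTE-> /negbTE-> /negbTE->.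
exact: pentagonal_K_w55.
Qed.

(** The triangles and pentagons complement the diagonal blocks chosen in
[pentagonal_K_31_lt].  Triangles are there because the number of edges left in
the skeleton need not be a multiple of 5. *)
Definition skeleton_triangles_45_55 : seq (nat * nat * nat) :=
  [:: (2, 12, 18); (1, 8, 23)].

Definition skeleton_pentagons_45_55 : seq (seq nat) := fives [::
   3;12;19;6;24; 5;20;8;14;2; 17;11;3;14;13; 14;12;17;6;1; 3;6;21;2;13;
   19;5;3;16;11; 4;24;2;8;21; 22;5;4;14;10; 15;13;18;11;1; 11;4;16;12;15;
   15;9;14;11;2; 3;21;9;24;8; 16;2;7;17;1; 15;10;16;9;4; 4;12;1;19;7;
   6;20;2;23;4; 4;10;3;15;8; 1;5;18;3;22; 22;8;16;13;4; 18;1;13;19;4;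
   22;7;18;6;2; 23;6;22;9;3; 20;3;19;2;9; 10;2;17;4;20; 10;1;20;7;24;
   21;7;1;24;5; 7;23;5;17;3; 1;21;10;23;9].

Definition skeleton_triangles_45_65 : seq (nat * nat * nat) :=
  [:: (1, 9, 22); (3, 9, 25)].

Definition skeleton_pentagons_45_65 : seq (seq nat) := fives [::
   2;18;7;25;5; 19;2;26;4;7; 3;12;19;13;17; 7;22;5;26;3; 5;24;8;23;1;
   13;16;2;25;1; 4;22;8;26;9; 23;5;18;13;3; 12;15;3;22;2; 1;10;26;7;21;
   2;14;4;25;6; 17;7;20;11;2; 24;2;20;5;4; 3;6;19;5;21; 21;6;23;7;2;
   12;4;19;3;14; 4;13;14;11;17; 16;4;18;1;11; 26;6;24;7;1; 1;19;11;18;12;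
   1;16;12;17;6; 10;3;18;6;22; 11;21;12;20;4; 4;10;14;1;15; 20;1;17;5;3;
   13;21;4;6;20; 10;24;3;11;15; 8;4;23;10;16; 9;24;1;8;2; 15;13;2;23;9;
   8;15;2;10;25; 16;9;14;8;3].

Definition skeleton_triangles_55_65 : seq (nat * nat * nat) :=
  [::].

Definition skeleton_pentagons_55_65 : seq (seq nat) := fives [::
   26;6;25;9;4; 13;20;3;12;16; 19;6;24;4;7; 6;27;7;26;2; 3;16;14;21;6;
   21;1;6;20;7; 28;6;22;14;3; 18;9;16;11;3; 10;24;8;16;1; 15;1;26;5;21;
   1;17;2;24;5; 4;15;22;5;27; 1;27;8;26;9; 3;9;2;15;17; 13;3;27;10;17;
   1;28;4;18;8; 2;7;24;1;13; 4;23;11;18;12; 4;21;13;23;5; 14;20;12;19;4;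
   4;22;12;17;11; 13;18;14;17;4; 2;11;22;13;19; 1;25;5;19;11; 6;23;7;25;4;
   15;18;10;4;16; 20;5;2;18;1; 20;11;21;12;2; 3;15;20;4;8; 8;17;9;27;2;
   3;24;9;28;7; 1;7;22;3;19; 23;15;19;14;1; 2;22;1;12;23; 3;23;14;2;25;
   10;25;8;28;2; 16;2;21;3;10; 3;5;28;10;26].

Definition skeleton_triangles_55_75 : seq (nat * nat * nat) :=
  [:: (3, 7, 27); (2, 6, 26); (3, 13, 23)].

Definition skeleton_pentagons_55_75 : seq (seq nat) := fives [::
   14;23;12;2;19; 4;23;7;29;8; 12;4;26;7;24; 8;18;4;5;27; 17;4;27;6;1;
   14;4;21;13;25; 7;30;10;27;2; 17;12;20;2;8; 15;17;13;19;4; 6;28;8;16;4;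
   13;4;28;5;24; 1;7;25;6;24; 25;4;7;21;5; 22;7;28;10;4; 15;16;12;18;2;
   5;22;15;23;2; 13;16;11;25;2; 30;2;22;6;3; 2;17;10;18;9; 5;29;4;24;3;
   13;22;11;4;20; 18;14;20;1;13; 12;25;15;18;1; 2;29;10;3;16; 1;19;10;16;9;
   14;17;9;28;1; 3;18;11;19;12; 3;21;12;22;14; 8;30;5;23;1; 15;20;8;19;3;
   1;27;9;19;15; 11;21;1;22;3; 2;24;15;21;14; 1;16;14;24;11; 2;21;6;23;11;
   26;10;2;28;3; 26;8;3;25;1; 9;26;5;1;30; 20;11;17;3;9; 9;4;30;6;29;
   29;1;10;20;3].

Definition skeleton_triangles_65_75 : seq (nat * nat * nat) :=
  [:: (2, 7, 27); (3, 6, 29); (1, 16, 27); (4, 5, 30)].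

Definition skeleton_pentagons_65_75 : seq (seq nat) := fives [::
   7;31;6;26;1; 1;14;27;3;11; 29;10;21;11;2; 25;6;28;1;13; 1;29;9;32;10;
   24;6;2;25;14; 12;20;14;18;1; 20;4;8;22;2; 21;14;3;22;12; 32;11;22;14;2;
   11;18;12;29;4; 30;11;20;9;3; 5;29;11;19;3; 7;25;17;21;3; 12;3;26;7;30;
   1;15;18;8;30; 1;8;29;7;23; 6;30;10;22;1; 10;2;28;9;31; 17;20;10;4;27;
   26;17;1;21;13; 2;26;5;27;15; 4;6;23;15;22; 17;24;3;10;18; 28;10;19;9;4;
   8;32;4;16;20; 19;1;9;21;16; 3;8;31;12;28; 3;32;6;27;13; 8;2;31;11;28;
   14;23;2;16;26; 4;12;19;13;24; 21;4;14;19;15; 17;19;8;21;2; 17;23;16;25;4;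
   23;4;19;2;5; 4;18;3;23;13; 13;22;17;3;20; 13;18;9;30;2; 4;26;15;24;7;
   22;9;2;18;16; 31;4;15;20;1; 1;5;28;7;32; 25;15;3;31;5; 24;5;32;12;2;
   16;3;25;1;24].

Lemma pentagonal_K_31_lt s t :
    s \in [:: 45; 55; 65; 75] -> t \in [:: 45; 55; 65; 75] -> s < t ->
    (s, t) != (45, 75) ->
  pentagonal_K 31 s t.
Proof.
rewrite !inE => /or4P[]/eqP-> /or4P[]/eqP-> // _ _.
- by apply: (@pentagonal_K_31_skeleton 3 3 3 3 3 5
    skeleton_triangles_45_55 skeleton_pentagons_45_55); vm_compute.
- by apply: (@pentagonal_K_31_skeleton 3 3 3 3 5 5
    skeleton_triangles_45_65 skeleton_pentagons_45_65); vm_compute.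
- by apply: (@pentagonal_K_31_skeleton 3 3 5 3 5 5
    skeleton_triangles_55_65 skeleton_pentagons_55_65); vm_compute.
- by apply: (@pentagonal_K_31_skeleton 3 3 5 5 5 5
    skeleton_triangles_55_75 skeleton_pentagons_55_75); vm_compute.
by apply: (@pentagonal_K_31_skeleton 3 5 5 5 5 5
  skeleton_triangles_65_75 skeleton_pentagons_65_75); vm_compute.
Qed.

Lemma harmonic_bound_nat (x y z : nat) : 0 < x ->
    (z%:R <= 4 * x%:R * y%:R / (x%:R + y%:R) :> rat)%R ->
  z * (x + y) <= 4 * x * y.
Proof.
move=> x_gt0; rewrite -GRing.natrD Num.Theory.ler_pdivlMr.
  by rewrite -!GRing.natrM Num.Theory.ler_nat.
by rewrite Num.Theory.ltr0n addn_gt0 x_gt0.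
Qed.

(** Indeed [75 * (31 + 45) = 5700] exceeds [4 * 31 * 45 = 5580]. *)
Lemma necessary_31_45_75 : ~ necessary_conditions 31 45 75.
Proof.
case=> _ _ /(_ 31 45 75 (perm_refl _) isT isT).
by move=> /(@harmonic_bound_nat 31 45 75 isT).
Qed.

Lemma necessary_31_75_45 : ~ necessary_conditions 31 75 45.
Proof.
case=> d [m1 m2] nec; apply: necessary_31_45_75; split=> // x y z pz.
by apply: nec; rewrite (perm_trans pz).
Qed.

Lemma pentagonal_K_31 s t :
    s \in [:: 45; 55; 65; 75] -> t \in [:: 45; 55; 65; 75] ->
    necessary_conditions 31 s t ->
  pentagonal_K 31 s t.
Proof.
move=> sP tP nec; have [lt_st|lt_ts|eq_st] := ltngtP s t.
- apply: pentagonal_K_31_lt => //; apply/eqP => -[es et].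
  by move: nec; rewrite es et; apply: necessary_31_45_75.
- apply/pentagonal_K_swap23/pentagonal_K_31_lt => //; apply/eqP => -[et es].
  by move: nec; rewrite es et; apply: necessary_31_75_45.
by rewrite -eq_st; apply: pentagonal_K_31_diag.
Qed.

(** * From lists of pentagons to partitions of the edge set *)

Lemma mem_arcs_next (V : eqType) (c : seq V) u v : pentagon c ->
  ((u, v) \in arcs c) =
    ((u \in c) && (v == next c u)) || ((v \in c) && (u == next c v)).
Proof.
case: c => [|a [|b [|c [|d [|e [|? ?]]]]]]; rewrite /pentagon ?andbF // andbT.
set p := [:: a; b; c; d; e] => Up.
have nextE : map (next p) p = rot 1 p.
  move: Up; rewrite /p /rot /= !inE !negb_or !eqxx.
  case/and5P=> /and4P[ab ac ad ae] /and3P[bc bd be] /andP[cd ce] de _.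
  have neg (x y : V) : x != y -> (y == x) = false.
    by move=> xy; rewrite eq_sym; apply/negbTE.
  by rewrite ?(neg _ _ ab, neg _ _ ac, neg _ _ ad, neg _ _ ae, neg _ _ bc,
    neg _ _ bd, neg _ _ be, neg _ _ cd, neg _ _ ce, neg _ _ de).
rewrite /arcs -nextE mem_cat.
have zipE : zip p (map (next p) p) = [seq (x, next p x) | x <- p] by [].
have zipE' : zip (map (next p) p) p = [seq (next p x, x) | x <- p] by [].
rewrite zipE zipE'; congr (_ || _).
  apply/mapP/andP => [[x xp [-> ->]]|[up /eqP ->]]; first by rewrite xp.
  by exists u.
apply/mapP/andP => [[x xp [-> ->]]|[up /eqP ->]]; first by rewrite xp.
by exists v.
Qed.

Lemma set2_eq (T : finType) (u v x y : T) :
  [set u; v] = [set x; y] -> (u, v) = (x, y) \/ (u, v) = (y, x).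
Proof.
move/setP => E; move: (E u) (E v) (E x) (E y).
rewrite !inE !eqxx !orbT => /esym/orP[]/eqP-> /esym/orP[]/eqP->; auto.
  by move=> _ /orP[]/eqP->; auto.
by move=> /orP[]/eqP->; auto.
Qed.

Lemma mem_cycle_edges (T : finType) (c : seq T) u v : pentagon c ->
  ([set u; v] \in cycle_edges c) = ((u, v) \in arcs c).
Proof.
move=> c5; rewrite mem_arcs_next //.
apply/imsetP/orP => [[x xc /set2_eq[][-> ->]]|].
- by left; rewrite xc /=.
- by right; rewrite xc /=.
case=> /andP[xc /eqP->]; first by exists u.
by exists v; rewrite // setUC.
Qed.

(** Since [e] takes the values 0 and 1 only, no edge lies on two members of the
list, so distinct cycles have disjoint edge sets. *)
Lemma has_cycle_decomposition_pentagonal (T : finType) (e : rel T) :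
  pentagonal e -> has_cycle_decomposition e 5.
Proof.
move=> [cs /allP cs5 cse].
have arc_e c u v : c \in cs -> (u, v) \in arcs c -> e u v.
  move=> ccs uv; rewrite -[e u v]lt0b -cse -has_count has_pred1.
  by apply/flattenP; exists (arcs c) => //; apply: map_f.
have edge_arc c E : c \in cs -> E \in cycle_edges c ->
    exists u v, E = [set u; v] /\ (u, v) \in arcs c.
  move=> ccs Ec; case/imsetP: (Ec) => x _ eE; exists x, (next c x); split=> //.
  by rewrite -mem_cycle_edges ?cs5 // -eE.
pose P := [set C in map (@cycle_edges T) cs].
have inP C : C \in P -> exists2 c, c \in cs & C = cycle_edges c.
  by rewrite inE => /mapP.
exists P; split; last first.
  move=> C /inP[c ccs ->]; exists c; have /andP[Uc /eqP sc] := cs5 c ccs.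
  split=> //; rewrite /ucycle Uc andbT.
  have : forall u v, (u, v) \in arcs c -> e u v by move=> u v; apply: arc_e.
  case: (c) sc => [|v0 [|v1 [|v2 [|v3 [|v4 []]]]]] //= _ arc.
  by rewrite !arc //= !inE eqxx ?orbT.
rewrite /partition; apply/and3P; split.
- rewrite eqEsubset; apply/andP; split; apply/subsetP => E.
    case/bigcupP => C /inP[c ccs ->] /(edge_arc c E ccs)[u [v [-> uv]]].
    by apply/imsetP; exists (u, v) => //; rewrite inE /=; apply: arc_e uv.
  case/imsetP=> -[u v]; rewrite inE /= => euv ->.
  have : (u, v) \in all_arcs cs by rewrite -has_pred1 has_count cse euv.
  case/flattenP=> _ /mapP[c ccs ->] uv.
  apply/bigcupP; exists (cycle_edges c); last by rewrite mem_cycle_edges ?cs5.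
  by rewrite inE map_f.
- apply/trivIsetP => _ _ /inP[c ccs ->] /inP[d dcs ->] neq.
  rewrite -setI_eq0; apply/set0Pn => -[E /setIP[Ec Ed]].
  have [u [v [eE uvc]]] := edge_arc c E ccs Ec.
  have uvd : (u, v) \in arcs d by rewrite -mem_cycle_edges ?cs5 // -eE.
  have neq_cd : d != c by apply: contraNneq neq => ->.
  have : 1 < count_mem (u, v) (all_arcs cs).
    rewrite (permP (perm_flatten (perm_map (@arcs T) (perm_to_rem ccs)))) /=.
    rewrite count_cat -addn1 leq_add //.
      by rewrite -has_count has_pred1.
    rewrite -has_count has_pred1; apply/flattenP; exists (arcs d) => //.
    apply: map_f; move: dcs.
    by rewrite (perm_mem (perm_to_rem ccs)) inE (negbTE neq_cd).
  by rewrite cse; case: (e u v).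
apply/negP => /inP[c ccs]; have /andP[_ /eqP sc] := cs5 c ccs.
case: c sc ccs => // x c _ _ /setP /(_ [set x; next (x :: c) x]).
by rewrite inE => /esym/negP[]; apply/imsetP; exists x; rewrite ?mem_head.
Qed.

Lemma complete_tripartite_decomposition r s t : 0 < r ->
  pentagonal_K r s t -> has_cycle_decomposition (@complete_tripartite r s t) 5.
Proof.
move=> r_gt0 rst; apply: has_cycle_decomposition_pentagonal.
pose A : seq (tripartite_vertex r s t) := [seq inl (inl i) | i <- enum 'I_r].
pose B : seq (tripartite_vertex r s t) := [seq inl (inr i) | i <- enum 'I_s].
pose C : seq (tripartite_vertex r s t) := [seq inr i | i <- enum 'I_t].
have U : uniq (A ++ B ++ C).
  rewrite !cat_uniq has_cat negb_or -!andbA; apply/and5P; split.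
  - by rewrite map_inj_uniq ?enum_uniq // => i j [].
  - by apply/hasPn => _ /mapP[i _ ->]; apply/mapP => -[].
  - by apply/hasPn => _ /mapP[i _ ->]; apply/mapP => -[].
  - by rewrite map_inj_uniq ?enum_uniq // => i j [].
  apply/andP; split; first by apply/hasPn => _ /mapP[i _ ->]; apply/mapP => -[].
  by rewrite map_inj_uniq ?enum_uniq // => i j [].
have := @pentagonal_lists _ A B C (inl (inl (Ordinal r_gt0))) U.
rewrite !size_map -!enumT !size_enum_ord => /(_ rst).
apply: pentagonal_ext => u v; congr nat_of_bool.
have pidx x : part_index A B C x = (part_of x).+1.
  have inA i : (inl (inl i) \in A) by apply: map_f; rewrite mem_enum.
  have inB i : (inl (inr i) \in B) by apply: map_f; rewrite mem_enum.
  have inC i : (inr i \in C) by apply: map_f; rewrite mem_enum.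
  have BA i : (inl (inr i) \in A) = false by apply/negP => /mapP[].
  have CA i : (inr i \in A) = false by apply/negP => /mapP[].
  have CB i : (inr i \in B) = false by apply/negP => /mapP[].
  by rewrite /part_index; case: x => [[i|i]|i] /=;
    rewrite ?inA ?BA ?inB ?CA ?CB ?inC.
by rewrite /tripartite /complete_tripartite !pidx eqSS.
Qed.

Theorem theorem4p9 (r s t : nat)
    (odd_r : odd r) (odd_s : odd s) (odd_t : odd t)
    (r_range : 31 <= r <= 75)
    (s_range : s \in [:: 45; 55; 65; 75])
    (t_range : t \in [:: 45; 55; 65; 75])
    (nec : necessary_conditions r s t) :
  has_cycle_decomposition (@complete_tripartite r s t) 5.
Proof.
apply: complete_tripartite_decomposition; first by case: r odd_r {r_range nec}.
have [r_ge33|r_lt33] := leqP 33 r.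
  apply: pentagonal_K_33_75 => //; lia.
have r31 : r = 31 by lia.
by rewrite r31 in nec *; apply: pentagonal_K_31.
Qed.
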